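(* Let $G=(V,E)$ be a connected Eulerian digraph and $s\in V$, and consider the chip-firing game on $G$ with sink $s$. Let $\mathcal{M}$ be the set of minimal recurrent configurations and $\mathcal{A}$ the set of maximal acyclic arc sets $A$ of $G$ such that $s$ is the unique vertex of in-degree $0$ in $G[A]$. Then every $c\in\mathcal{M}$ has exactly one firing graph $\mathcal{F}_c$, and the map $\mathcal{M}\to\mathcal{A}$, $c\mapsto$ (arc set of $\mathcal{F}_c$), is well defined and bijective.
   Context: Digraphs are finite and simple; Eulerian means in-degree equals out-degree at every vertex. For $A\subseteq E$, $G[A]$ is the digraph $(V,A)$; $A$ is an acyclic arc set if $G[A]$ has no directed cycle; it is maximal if $A\cup\{e\}$ is not acyclic for every $e\in E\setminus A$. Chip-firing: let $G_s$ be $G$ with all arcs of tail $s$ deleted. A configuration is a map $c:V\setminus\{s\}\to\mathbb{N}$. A vertex $v\neq s$ is active if $c(v)\ge\mathrm{outdeg}_G(v)\ge1$; firing $v$ subtracts $\mathrm{outdeg}_G(v)$ from $c(v)$ and adds one chip to each out-neighbour $w\ne s$ of $v$ (chips sent to $s$ vanish). Legal firing = firing an active vertex; $c\to^*d$ means reachable by legal firings; $c$ is stable if no vertex is active; every configuration $c$ reaches by legal firings a unique stable configuration $c^\circ$. $c$ is accessible if for every configuration $d$ there is $d'$ with $d+d'\to^*c$; $c$ is recurrent if stable and accessible. For configurations, $c'\le c$ means componentwise. A recurrent $c$ is minimal if no recurrent $c'\neq c$ satisfies $c'\le c$. Let $\beta(v)=1$ if $(s,v)\in E$ and $\beta(v)=0$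 otherwise. It is known that if $c$ is recurrent then $(c+\beta)^\circ=c$ and any legal firing sequence from $c+\beta$ to $c$ fires each vertex of $V\setminus\{s\}$ exactly once. Firing graph: if $c$ is recurrent and $(w_1,\dots,w_k)$ is a legal firing sequence from $c+\beta$ ending at $c$, the corresponding firing graph of $c$ is the digraph with vertex set $V$ and arc set $\{(s,w_i):(s,w_i)\in E\}\cup\{(w_i,w_j): i<j,\ (w_i,w_j)\in E\}$. *)

(* Defs.v *)
From mathcomp Require Import all_boot.
From mathcomp Require Import classical_sets functions.

Set Implicit Arguments.
Unset Strict Implicit.
Unset Printing Implicit Defensive.

(* A digraph on the vertex type T is its arc set E : {set T * T}, so multiple
   arcs are excluded, while opposite arcs (x, y) and (y, x) are allowed.  The
   spanning subdigraph G[A] is A itself. *)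
Definition arc (T : finType) (A : {set T * T}) : rel T :=
  fun x y => (x, y) \in A.

Definition outdeg (T : finType) (A : {set T * T}) (v : T) : nat :=
  #|[set w | arc A v w]|.

Definition indeg (T : finType) (A : {set T * T}) (v : T) : nat :=
  #|[set u | arc A u v]|.

Definition loopless (T : finType) (E : {set T * T}) : Prop :=
  irreflexive (arc E).

(* Connectedness of the underlying undirected graph. *)
Definition connected_digraph (T : finType) (E : {set T * T}) : Prop :=
  forall x y : T, connect (fun u v => arc E u v || arc E v u) x y.

Definition eulerian (T : finType) (E : {set T * T}) : Prop :=
  forall v : T, indeg E v = outdeg E v.

Definition acyclic (T : finType) (A : {set T * T}) : Prop :=
  forall p : seq T, p != [::] -> ~ ucycle (arc A) p.

Definition maximal_acyclic (T : finType) (E A : {set T * T}) : Prop :=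
  [/\ A \subset E, acyclic A &
      forall a : T * T, a \in E :\: A -> ~ acyclic (a |: A)].

Definition max_acyclic_from (T : finType) (E : {set T * T}) (s : T) :
    set {set T * T} :=
  fun A => maximal_acyclic E A /\ (forall v : T, indeg A v = 0 <-> v = s).

Definition nonsink (T : finType) (s : T) : finType := {v : T | v != s}.

Definition config (T : finType) (s : T) := {ffun nonsink s -> nat}.

Section ChipFiring.
Context (T : finType) (E : {set T * T}) (s : T).
Implicit Types (c d : config s) (v w : nonsink s) (ws : seq (nonsink s)).

Definition add_config c d : config s := [ffun v => c v + d v].

Definition le_config c d : Prop := forall v, c v <= d v.

Definition active c v : bool :=
  (outdeg E (val v) <= c v) && (1 <= outdeg E (val v)).

(* Truncated subtraction is harmless: only active vertices are fired in legal
   sequences. *)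
Definition fire c v : config s :=
  [ffun w => (c w - (if w == v then outdeg E (val v) else 0))
             + (if arc E (val v) (val w) then 1 else 0)].

Fixpoint legal_firing c ws d : Prop :=
  if ws is w :: ws' then active c w /\ legal_firing (fire c w) ws' d
  else c = d.

Definition reaches c d : Prop := exists ws, legal_firing c ws d.

Definition stable c : Prop := forall v, ~~ active c v.

Definition accessible c : Prop :=
  forall d, exists d', reaches (add_config d d') c.

Definition recurrent c : Prop := stable c /\ accessible c.

Definition min_recurrent : set (config s) :=
  fun c => recurrent c /\
    ~ (exists c', [/\ recurrent c', c' <> c & le_config c' c]).

Definition beta : config s := [ffun v => if arc E s (val v) then 1 else 0].

Definition firing_arcs ws : {set T * T} :=
  let w (i : 'I_(size ws)) : T := val (tnth (in_tuple ws) i) in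
  [set (s, w i) | i : 'I_(size ws) & arc E s (w i)] :|:
  [set (w p.1, w p.2) | p : 'I_(size ws) * 'I_(size ws) &
                        (p.1 < p.2) && arc E (w p.1) (w p.2)].

(* All firing graphs have vertex set T; F is the arc set. *)
Definition is_firing_graph c (F : {set T * T}) : Prop :=
  exists ws, legal_firing (add_config c beta) ws c /\ F = firing_arcs ws.

End ChipFiring.

(* Main.v *)
(* For an acyclic arc set [A] whose only source is [s], let
   c_A v = outdeg v - indeg_A v.  A legal firing sequence from [c + beta] to [c]
   is an ordering of the nonsink vertices whose set [F] of forward arcs satisfies
   c_F <= c; ordering the vertices along [A] shows, by the burning criterion,
   that every c_A is recurrent.  Hence a minimal recurrent [c] equals c_F for
   each of its firing graphs [F], and [F] is maximal, since an additional arc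
   would lower c_F.  Conversely, if [A] is maximal and c_F <= c_A then F = A (see
   maximal_acyclic_indeg); this yields the minimality of c_A, the uniqueness of
   the firing graph, and surjectivity, while injectivity is c = c_F. *)
From mathcomp Require Import classical_sets functions.
From mathcomp Require Import all_boot.
Require Import Defs.

Set Implicit Arguments.
Unset Strict Implicit.
Unset Printing Implicit Defensive.

Section Digraph.
Context (T : finType).
Implicit Types (A E F : {set T * T}) (S : {set T}).

(** * Degrees in Eulerian digraphs *)

Lemma indegE A v : indeg A v = \sum_u arc A u v.
Proof.
rewrite /indeg -sum1_card big_mkcond /=; apply: eq_bigr => u _.
by rewrite inE; case: (arc A u v).
Qed.

Lemma outdegE A u : outdeg A u = \sum_v arc A u v.
Proof.
rewrite /outdeg -sum1_card big_mkcond /=; apply: eq_bigr => v _.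
by rewrite inE; case: (arc A u v).
Qed.

Lemma indeg_gt0P A v : reflect (exists u, arc A u v) (0 < indeg A v).
Proof.
apply: (iffP card_gt0P) => -[u]; first by rewrite inE; exists u.
by move=> uv; exists u; rewrite inE.
Qed.

Lemma indeg_sub A E v : A \subset E -> indeg A v <= indeg E v.
Proof.
move=> sAE; apply: subset_leq_card; apply/subsetP => u; rewrite !inE.
exact: (subsetP sAE (u, v)).
Qed.

Lemma indeg_setU1 A u v w : (u, v) \notin A ->
  indeg ((u, v) |: A) w = (w == v) + indeg A w.
Proof.
move=> uvA; have [->|wv] := eqVneq w v; last first.
  by apply: eq_card => x; rewrite !inE /arc !inE xpair_eqE (negPf wv) andbF.
transitivity #|u |: [set x | arc A x v]|.
  by apply: eq_card => x; rewrite !inE /arc !inE xpair_eqE eqxx andbT.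
by rewrite cardsU1 inE uvA.
Qed.

Lemma arc_sum_leq_outdeg A S u : \sum_(v in S) arc A u v <= outdeg A u.
Proof.
by rewrite outdegE [X in _ <= X](bigID (mem S)) /= leq_addr.
Qed.

(* Counting the arcs with tail in [S] and those with head in [S] shows that a
   set without entering arcs has no leaving arcs either. *)
Lemma eulerian_pred_closed E S x : connected_digraph E -> eulerian E ->
  (forall u v, arc E u v -> v \in S -> u \in S) -> x \in S -> S = [set: T].
Proof.
move=> conE eulE clS xS.
have inS : \sum_(v in S) indeg E v = \sum_(u in S) \sum_(v in S) arc E u v.
  rewrite exchange_big /=; apply: eq_bigr => v vS.
  rewrite indegE [RHS]big_mkcond /=; apply: eq_bigr => u _.
  case: ifPn => // uS; case uv: (arc E u v) => //.
  by rewrite (clS _ _ uv vS) in uS.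
have outS u v : arc E u v -> u \in S -> v \in S.
  move=> uv uS.
  have : \sum_(u in S) \sum_(v in S) arc E u v = \sum_(u in S) outdeg E u.
    by rewrite -inS; apply: eq_bigr.
  (* Each inner sum is at most the out-degree, so equal totals force equality at every [u]. *)
  move/eqP; have := leqif_sum (fun u (_ : u \in S) =>
    leqif_geq (arc_sum_leq_outdeg E S u)).
  move=> [_ ->] /forall_inP/(_ u uS).
  rewrite outdegE [X in X <= _](bigID (mem S)) /= -[X in _ <= X]addn0.
  rewrite leq_add2l leqn0 sum_nat_eq0 => /forall_inP/(_ v).
  by rewrite uv; case: (v \in S) => //= /(_ isT).
apply/setP => y; rewrite inE.
have clo : closed (fun u v => arc E u v || arc E v u) S.
  move=> u v /= /orP[] uv; apply/idP/idP => [uS|vS].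
  - exact: outS uv uS.
  - exact: clS uv vS.
  - exact: clS uv uS.
  - exact: outS uv vS.
by rewrite -(closed_connect clo (conE x y)).
Qed.

(** A vertex without leaving arcs would have no entering arcs either, so its singleton would be
    closed under predecessors. *)
Lemma eulerian_outdeg_gt0 E u v : connected_digraph E -> eulerian E ->
  u != v -> 0 < outdeg E u.
Proof.
move=> conE eulE; apply: contra_neqT; rewrite -leqNgt leqn0 => /eqP out0.
have : [set u] = [set: T].
  apply: (@eulerian_pred_closed E _ u) => //; last exact: set11.
  move=> x y xy; rewrite !inE => /eqP yu; move: xy; rewrite yu => xu.
  by have : 0 < indeg E u; [apply/indeg_gt0P; exists x|rewrite eulE out0].
by move/setP/(_ v); rewrite !inE => /eqP.
Qed.

Lemma eulerian_connect E u v : connected_digraph E -> eulerian E ->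
  connect (arc E) u v.
Proof.
move=> conE eulE.
have : [set x | connect (arc E) x v] = [set: T].
  apply: (@eulerian_pred_closed E _ v) => //; last by rewrite inE.
  by move=> x y xy; rewrite !inE; apply: connect_trans (connect1 xy).
by move/setP/(_ u); rewrite !inE.
Qed.

(* Maximum principle. *)
Lemma eulerian_harmonic E (y : T -> nat) : connected_digraph E -> eulerian E ->
  (forall v, \sum_u arc E u v * y u = outdeg E v * y v) ->
  forall u v, y u = y v.
Proof.
move=> conE eulE harm u v.
pose m := [arg max_(x > u) y x].
have ym x : y x <= y m by rewrite /m; case: arg_maxnP => // i _; apply.
have : [set x | y x == y m] = [set: T].
  apply: (@eulerian_pred_closed E _ m) => //; last by rewrite inE.
  move=> x z xz; rewrite !inE => /eqP yz.
  have := harm z; rewrite -eulE indegE big_distrl yz => /eqP.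
  have le i : true -> arc E i z * y i <= arc E i z * y m ?=
      iff (arc E i z * y m <= arc E i z * y i).
    by move=> _; apply: leqif_geq; rewrite leq_mul2l ym orbT.
  rewrite (leqif_sum le) => /forall_inP/(_ x isT).
  by rewrite xz !mul1n eqn_leq ym.
by move/setP => Sm; have := Sm u; have := Sm v; rewrite !inE => /eqP-> /eqP->.
Qed.

(** * Rankings and acyclic arc sets *)

Definition ranked (r : T -> nat) A := forall u v, arc A u v -> r u < r v.

Lemma ranked_acyclic r A : ranked r A -> acyclic A.
Proof.
move=> rA [|x p] // _ /andP[+ _]; rewrite /cycle.
move/(sub_path rA) => /(order_path_min (fun _ _ _ => @ltn_trans _ _ _)).
by rewrite all_rcons ltnn.
Qed.

(** Along an arc [(u, v)] the ancestors of [u] are ancestors of [v], and [v] itself is a new one,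
    since otherwise a cycle would arise. *)
Lemma acyclic_ranked A : acyclic A ->
  ranked (fun v => #|[set u | connect (arc A) u v]|) A.
Proof.
move=> acA u v uv; apply: proper_card; apply/properP; split.
  apply/subsetP => x; rewrite !inE => /connect_trans; apply; exact: connect1.
exists v; rewrite !inE // ; apply/negP => /connectP[p vp uE].
case/shortenP: vp uE => q vq uq _ uE.
apply: (acA (v :: q)) => //.
by rewrite /ucycle uq andbT /cycle rcons_path vq -uE.
Qed.

(** Raising all descendants of [v] by [r u + 1] lifts [v] above [u], which keeps its rank because it
    is not one of them. *)
Lemma acyclic_setU1 A u v : acyclic A -> ~~ connect (arc A) v u ->
  acyclic ((u, v) |: A).
Proof.
move=> /acyclic_ranked; set r := (X in ranked X _) => rA nvu.
apply: (@ranked_acyclic (fun w => r w + connect (arc A) v w * (r u).+1)).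
move=> x y; rewrite {1}/arc !inE => /orP[/eqP[-> ->]|xy].
  by rewrite (negPf nvu) connect0 mul1n addn0 ltn_addl.
rewrite -addSn leq_add ?rA // leq_mul2r.
case vx: (connect _ v x) => //.
by rewrite (connect_trans vx (connect1 xy)).
Qed.

Lemma ranked_source_min r A s : ranked r A ->
  (forall v, indeg A v = 0 -> v = s) -> forall v, r s <= r v.
Proof.
move=> rA src v; have [n] := ubnP (r v); elim: n v => // n IHn v.
rewrite ltnS => rv; case: (posnP (indeg A v)) => [/src -> //|].
case/indeg_gt0P => u /rA uv.
exact: leq_trans (IHn _ (leq_trans uv rv)) (ltnW uv).
Qed.

(* Let [v] be a first vertex, along a ranking of [F], entered by an arc [(u, v)]
   of [F] outside [A].  Below [v] the sets [A] and [F] have the same arcs, so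
   the path of [A] from [v] to [u] given by maximality lies in [F] and the rank
   increases around a cycle. *)
Lemma maximal_acyclic_indeg E A F : maximal_acyclic E A ->
  F \subset E -> acyclic F -> (forall v, indeg A v <= indeg F v) -> F = A.
Proof.
move=> [sAE acA maxA] sFE /acyclic_ranked; set r := (X in ranked X _) => rF le.
have eq_of_sub v : (forall u, arc F u v -> arc A u v) ->
    forall u, arc A u v = arc F u v.
  move=> sub u.
  suff /setP/(_ u) : [set u | arc F u v] = [set u | arc A u v] by rewrite !inE.
  apply/eqP; rewrite eqEcard le andbT; apply/subsetP => w.
  by rewrite !inE; apply: sub.
suff sub v : forall u, arc F u v -> arc A u v.
  by apply/setP => -[u v]; rewrite -[LHS](eq_of_sub _ (sub v)).
have [n] := ubnP (r v); elim: n v => // n IHn v; rewrite ltnS => rv u uv.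
apply: contraT => uvA.
have vu : connect (arc A) v u.
  apply: contraT => nvu; exfalso; apply: (maxA (u, v)).
    by rewrite inE uvA (subsetP sFE).
  exact: acyclic_setU1.
have back w : connect (arc A) v w -> r w < r v -> False.
  case/connectP => p; elim/last_ind: p w => [|p z IHp] w.
    by move=> _ ->; rewrite ltnn.
  rewrite rcons_path last_rcons => /andP[vp pz] -> rz.
  have Fz : arc F (last v p) z.
    by rewrite -(eq_of_sub z) // => x; apply: IHn; apply: leq_trans rz rv.
  exact: (IHp _ vp erefl (ltn_trans (rF _ _ Fz) rz)).
by case: (back u vu (rF _ _ uv)).
Qed.

End Digraph.

Section ChipFiring.
Context (T : finType) (E : {set T * T}) (s : T).
Implicit Types (c d e : config s) (v w : nonsink s) (ws : seq (nonsink s)).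

Local Notation legal := (legal_firing E).
Local Notation reach := (reaches E).
Local Notation inflow ws v := (count (fun u => arc E (val u) (val v)) ws).

(** * Legal firing sequences and confluence *)

Lemma add_configC c d : add_config c d = add_config d c.
Proof. by apply/ffunP => v; rewrite !ffunE addnC. Qed.

Lemma add_configA c d e :
  add_config c (add_config d e) = add_config (add_config c d) e.
Proof. by apply/ffunP => v; rewrite !ffunE addnA. Qed.

Lemma active_add c e v : active E c v -> active E (add_config c e) v.
Proof. case/andP=> cv ?; apply/andP; split=> //.
by rewrite ffunE; apply: leq_trans cv (leq_addr _ _). Qed.

Lemma fire_add c e v : active E c v ->
  fire E (add_config c e) v = add_config (fire E c v) e.
Proof.
case/andP=> cv _; apply/ffunP => w; rewrite !ffunE addnAC; congr (_ + _).
by case: eqVneq => [->|_]; rewrite ?subn0 // addnBAC.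
Qed.

Lemma active_fire c v w : v != w -> active E c v -> active E (fire E c w) v.
Proof.
move=> vw /andP[cv ?]; apply/andP; split=> //.
by rewrite ffunE (negPf vw) subn0; apply: leq_trans cv (leq_addr _ _).
Qed.

Lemma fireC c v w : active E c v -> active E c w ->
  fire E (fire E c v) w = fire E (fire E c w) v.
Proof.
move=> /andP[cv _] /andP[cw _]; have [->//|vw] := eqVneq v w.
apply/ffunP => x; rewrite !ffunE.
have [->|xw] := eqVneq x w.
  by rewrite eq_sym (negPf vw) !subn0 addnAC -addnBAC.
by have [->|xv] := eqVneq x v; rewrite !subn0 addnAC // -addnBAC.
Qed.

Lemma legal_cat c d e ws ws' :
  legal c ws d -> legal d ws' e -> legal c (ws ++ ws') e.
Proof.
elim: ws c => [c /= -> //|v ws IHws c /= [cv lws] lws']; split=> //.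
exact: IHws.
Qed.

Lemma legal_catP c e ws ws' :
  legal c (ws ++ ws') e -> exists2 d, legal c ws d & legal d ws' e.
Proof.
elim: ws c => [c l|v ws IHws c /= [cv /IHws[d l l']]]; first by exists c.
by exists d.
Qed.

Lemma legal_add c d e ws :
  legal c ws d -> legal (add_config c e) ws (add_config d e).
Proof.
elim: ws c => [c /= -> //|v ws IHws c /= [cv lws]]; split.
  exact: active_add.
by rewrite fire_add //; apply: IHws.
Qed.

(** Chips at [v] are conserved; the chips lost stand on the left so that no truncated subtraction
    occurs. *)
Lemma legal_balance c d ws v : legal c ws d ->
  d v + outdeg E (val v) * count_mem v ws = c v + inflow ws v.
Proof.
elim: ws c => [c /= -> |w ws IHws c /= [/andP[cw _] /IHws]].
  by rewrite muln0.
rewrite mulnDr addnCA => ->; rewrite ffunE eq_sym.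
have [wv|_] := eqVneq v w; last first.
  by rewrite muln0 subn0 add0n addnA; case: arc.
by move: cw; rewrite -wv muln1 !addnA => cw; rewrite subnKC //; case: arc.
Qed.

Lemma reach_refl c : reach c c.
Proof. by exists [::]. Qed.

Lemma reach_trans d c e : reach c d -> reach d e -> reach c e.
Proof. by move=> [ws l] [ws' l']; exists (ws ++ ws'); apply: legal_cat l'. Qed.

Lemma reach_add c d c' d' :
  reach c d -> reach c' d' -> reach (add_config c c') (add_config d d').
Proof.
move=> [ws l] [ws' l']; apply: (@reach_trans (add_config d c')).
  by exists ws; apply: legal_add.
by exists ws'; rewrite !(add_configC d); apply: legal_add.
Qed.

Lemma reach_fire c v : active E c v -> reach c (fire E c v).
Proof. by exists [:: v]. Qed.

(* An active vertex stays active until it is fired, so the sequence leading to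
   the stable [d] fires [v], and that firing can be moved to the front. *)
Lemma reach_stable_fire c d v :
  active E c v -> stable E d -> reach c d -> reach (fire E c v) d.
Proof.
move=> cv std [ws]; elim: ws c cv => [c cv /= cd|w ws IHws c cv /= [cw l]].
  by move: (std v); rewrite -cd cv.
have [vw|vw] := eqVneq v w; first by exists ws; rewrite vw.
apply: reach_trans (IHws _ (active_fire vw cv) l).
rewrite fireC //; apply: reach_fire; apply: active_fire => //.
by rewrite eq_sym.
Qed.

Lemma reach_stable_confluent c d e :
  stable E d -> reach c d -> reach c e -> reach e d.
Proof.
move=> std cd [ws]; elim: ws c cd => [c cd /= <- //|v ws IHws c cd /= [cv]].
by apply: IHws; apply: reach_stable_fire.
Qed.

(** No entry occurs twice, so before its turn [v] has only gained chips. *)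
Lemma legal_exists c ws : uniq ws ->
  (forall ws1 v ws2, ws = ws1 ++ v :: ws2 ->
     0 < outdeg E (val v) <= c v + inflow ws1 v) ->
  exists d, legal c ws d.
Proof.
elim: ws c => [c _ _|v ws IHws c /= /andP[vws uws] ok]; first by exists c.
have cv : active E c v.
  by have := ok [::] v ws erefl; rewrite /= addn0 andbC.
have [ws1 w ws2 wsE|d l] := IHws (fire E c v) uws; last by exists d.
have wv : w != v.
  by apply: contraNneq vws => <-; rewrite wsE mem_cat mem_head orbT.
have := ok (v :: ws1) w ws2; rewrite wsE => /(_ erefl) /=.
by rewrite ffunE (negPf wv) subn0 addnA; case: arc.
Qed.

Lemma nonsinkP u : u = s \/ exists u' : nonsink s, u = val u'.
Proof.
by have [|us] := eqVneq u s; [left | right; exists (exist _ u us)].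
Qed.

(** * Multiples of a configuration *)

Definition scale_config k c : config s := [ffun v => k * c v].

Lemma scale_configD k l c :
  scale_config (k + l) c = add_config (scale_config k c) (scale_config l c).
Proof. by apply/ffunP => v; rewrite !ffunE mulnDl. Qed.

Lemma scale_configM k l c :
  scale_config (k * l) c = scale_config k (scale_config l c).
Proof. by apply/ffunP => v; rewrite !ffunE mulnA. Qed.

Lemma scale_config0 c : scale_config 0 c = [ffun=> 0].
Proof. by apply/ffunP => v; rewrite !ffunE. Qed.

Lemma scale_config1 c : scale_config 1 c = c.
Proof. by apply/ffunP => v; rewrite !ffunE mul1n. Qed.

Lemma reach_scale k c d :
  reach c d -> reach (scale_config k c) (scale_config k d).
Proof.
move=> cd; elim: k => [|k IHk].
  by rewrite !scale_config0; apply: reach_refl.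
by rewrite -addn1 !scale_configD !scale_config1; apply: reach_add.
Qed.

(** * In-degrees in firing graphs *)

Lemma count_sumE (P : pred T) (l : seq T) :
  count P l = \sum_u P u * count_mem u l.
Proof.
elim: l => [|x l IHl] /=; first by rewrite big1 // => u _; rewrite muln0.
under eq_bigr do rewrite mulnDr.
rewrite big_split /= -IHl (bigD1 x) //= eqxx muln1 big1 ?addn0 // => u ux.
by rewrite eq_sym (negPf ux) muln0.
Qed.

Lemma beta_inflow ws v :
  beta E s v + inflow ws v = count (fun u => arc E u (val v)) (s :: map val ws).
Proof. by rewrite ffunE /= count_map; case: arc. Qed.

(** Putting [s] in front brings both kinds of arcs in [firing_arcs] under one order, as its forward
    arcs. *)
Definition firing_rank ws (u : T) := index u (s :: map val ws).

Lemma firing_rank_sink ws : firing_rank ws s = 0.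
Proof. by rewrite /firing_rank /= eqxx. Qed.

Lemma firing_rank_val ws v : firing_rank ws (val v) = (index v ws).+1.
Proof.
by rewrite /firing_rank /= eq_sym (negPf (valP v)) index_map //; apply: val_inj.
Qed.

Lemma arc_firing_arcs ws (u v : T) : uniq ws -> (forall w, w \in ws) ->
  arc (firing_arcs E ws) u v =
    arc E u v && (firing_rank ws u < firing_rank ws v).
Proof.
move=> uws ws_all; have rk i :
    firing_rank ws (val (tnth (in_tuple ws) i)) = i.+1.
  rewrite firing_rank_val (tnth_nth (tnth (in_tuple ws) i)) /=.
  by rewrite index_uniq.
have ix w : {i : 'I_(size ws) | tnth (in_tuple ws) i = w}.
  have wi : index w ws < size ws by rewrite index_mem.
  by exists (Ordinal wi); rewrite (tnth_nth w) /= nth_index.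
apply/idP/andP.
  rewrite /arc inE => /orP[] /imsetP[].
    by move=> i; rewrite inE => si [-> ->]; rewrite firing_rank_sink rk.
  move=> [i j]; rewrite inE /= => /andP[ij wij] [-> ->].
  by rewrite !rk.
move=> [uv]; rewrite {1}/arc inE.
have [->|[v' vE]] := nonsinkP v; first by rewrite firing_rank_sink ltn0.
move: uv; rewrite vE; have [j <-] := ix v'.
have [->|[u' ->]] := nonsinkP u.
  by move=> sv _; apply/orP; left; apply/imsetP; exists j; rewrite ?inE.
have [i <-] := ix u'; rewrite !rk ltnS => uv ij.
by apply/orP; right; apply/imsetP; exists (i, j); rewrite ?inE ?ij.
Qed.

(** The in-neighbours of [v] in the firing graph are the vertices that send it a chip before it
    fires, with [beta] standing for [s]. *)
Lemma indeg_firing_arcs ws1 ws2 v :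
  uniq (ws1 ++ v :: ws2) -> (forall w, w \in ws1 ++ v :: ws2) ->
  indeg (firing_arcs E (ws1 ++ v :: ws2)) (val v) = beta E s v + inflow ws1 v.
Proof.
move=> uws ws_all; rewrite indegE beta_inflow count_sumE.
set ws := ws1 ++ v :: ws2; apply: eq_bigr => u _.
rewrite arc_firing_arcs // -mulnb; congr (_ * _).
have ul : uniq (s :: map val ws).
  rewrite /= map_inj_uniq ?uws ?andbT //; last exact: val_inj.
  apply/negP => /mapP[w _ sw].
  by have := valP w; rewrite /= -[X in X != _]sw eqxx.
(* The vertices ranked below [v] form a prefix of a list without repetition, so each is counted
   once. *)
have lE : s :: map val ws1 = take (firing_rank ws (val v)) (s :: map val ws).
  rewrite firing_rank_val index_cat /= eqxx addn0 map_cat.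
  have /negPf -> : v \notin ws1.
    by move: uws; rewrite cat_uniq => /and3P[_ /hasPn/(_ v (mem_head _ _))].
  by rewrite -(size_map val) take_size_cat.
rewrite lE count_uniq_mem ?take_uniq // in_take //.
have [->|[u' ->]] := nonsinkP u; first exact: mem_head.
by rewrite inE map_f ?orbT.
Qed.

(** * The burning criterion *)

Context (conE : connected_digraph E) (eulE : eulerian E).

Lemma nonsink_outdeg_gt0 v : 0 < outdeg E (val v).
Proof. exact: eulerian_outdeg_gt0 (valP v). Qed.

Lemma count_mem_val v ws : count_mem (val v) (s :: map val ws) = count_mem v ws.
Proof.
rewrite /= eq_sym (negPf (valP v)) count_map; apply: eq_count => w /=.
exact: val_eqE.
Qed.

Lemma count_mem_sink ws : count_mem s (s :: map val ws) = 1.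
Proof.
rewrite /= eqxx count_map (@eq_count _ _ pred0) ?count_pred0 // => w /=.
exact: negPf (valP w).
Qed.

(** Each nonsink loses its out-degree and gains its in-degree, the arc from [s] being paid by
    [beta]; in an Eulerian digraph these cancel. *)
Lemma burning_end c d ws :
  (forall v, count_mem v ws = 1) -> legal (add_config c (beta E s)) ws d ->
  d = c.
Proof.
move=> ws1 l; apply/ffunP => v; apply/eqP.
rewrite -(eqn_add2r (outdeg E (val v))).
have := legal_balance v l; rewrite ws1 muln1 => ->.
rewrite ffunE -addnA beta_inflow count_sumE eqn_add2l -eulE indegE; apply/eqP.
apply: eq_bigr => u _; have [->|[u' ->]] := nonsinkP u.
  by rewrite count_mem_sink muln1.
by rewrite count_mem_val ws1 muln1.
Qed.

(* With one firing of [s] added, the numbers of firings are harmonic: at the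
   nonsinks because [c + beta] returns to [c], hence at [s] by summation. *)
Lemma burning_count c ws :
  legal (add_config c (beta E s)) ws c -> forall v, count_mem v ws = 1.
Proof.
move=> l v; pose y u := count_mem u (s :: map val ws).
rewrite -count_mem_val -(count_mem_sink ws).
apply: (@eulerian_harmonic _ E y) => // {v}.
have harm (v : T) : v != s -> \sum_u arc E u v * y u = outdeg E v * y v.
  have [->|[v' -> _]] := nonsinkP v; first by rewrite eqxx.
  rewrite -(count_sumE (fun u => arc E u (val v'))) -beta_inflow.
  rewrite /y count_mem_val; apply/eqP.
  rewrite -(eqn_add2l (c v')) (legal_balance v' l) addnA.
  by rewrite [in X in _ == X]ffunE.
move=> v; have [->|] := eqVneq v s; last exact: harm.
have : \sum_v \sum_u arc E u v * y u = \sum_v outdeg E v * y v.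
  rewrite exchange_big /=; apply: eq_bigr => u _.
  by rewrite outdegE big_distrl.
rewrite (bigD1 s) //= [RHS](bigD1 s) //= (eq_bigr _ harm).
by move/eqP; rewrite eqn_add2r => /eqP.
Qed.

Lemma burning_uniq c ws : legal (add_config c (beta E s)) ws c ->
  uniq ws /\ forall v, v \in ws.
Proof.
move/burning_count => ws1; have ws_all v : v \in ws.
  by rewrite -has_pred1 has_count ws1.
split=> //; apply: count_mem_uniq => v.
by rewrite ws1 ws_all.
Qed.

(** By [indeg_firing_arcs], the inequality says that each vertex holds enough chips at its turn. *)
Lemma burning_legal c ws : uniq ws -> (forall v, v \in ws) ->
  (forall v, outdeg E (val v) <= c v + indeg (firing_arcs E ws) (val v)) ->
  legal (add_config c (beta E s)) ws c.
Proof.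
move=> uws ws_all le.
have [|d l] := @legal_exists (add_config c (beta E s)) ws uws.
  move=> ws1 v ws2 wsE; rewrite nonsink_outdeg_gt0 ffunE -addnA.
  subst ws; rewrite -(indeg_firing_arcs uws ws_all); exact: le.
have dc : d = c.
  by apply: burning_end l => v; rewrite count_uniq_mem // ws_all.
by rewrite dc in l.
Qed.

(** At its only firing, [v] is active and holds [c v] plus one chip per arc of the firing graph
    entering it. *)
Lemma burning_indeg c ws v : legal (add_config c (beta E s)) ws c ->
  outdeg E (val v) <= c v + indeg (firing_arcs E ws) (val v).
Proof.
move=> l; have [uws ws_all] := burning_uniq l.
have vws := ws_all v; move: vws uws ws_all l => /splitPr[ws1 ws2] uws ws_all.
rewrite indeg_firing_arcs // => /legal_catP[d l [/andP[dv _] _]].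
have v1 : count_mem v ws1 = 0.
  apply/eqP; rewrite -leqn0 leqNgt -has_count has_pred1.
  by move: uws; rewrite cat_uniq => /and3P[_ /hasPn/(_ v (mem_head _ _))].
have := legal_balance v l; rewrite v1 muln0 addn0 ffunE -addnA => <-.
exact: dv.
Qed.

(** Chips are pushed along a path from [s]: [outdeg u] copies of a configuration with a chip on [u]
    make [u] active, and firing it puts a chip on the next vertex. *)
Lemma reach_scale_beta_gt0 v :
  exists k x, reach (scale_config k (beta E s)) x /\ 0 < x v.
Proof.
have /connectP[p] := eulerian_connect s (val v) conE eulE.
elim/last_ind: p v => [v _ /= vs|p z IHp v].
  by have := valP v; rewrite /= vs eqxx.
rewrite rcons_path last_rcons => /andP[sp uz] zv; move: uz; rewrite -zv {z zv}.
have [->|[u uE]] := nonsinkP (last s p).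
  move=> sv; exists 1, (beta E s); rewrite scale_config1 ffunE sv.
  by split=> //; apply: reach_refl.
rewrite uE => uv; have [k [x [kx xu]]] := IHp u sp (esym uE).
exists (outdeg E (val u) * k), (fire E (scale_config (outdeg E (val u)) x) u).
split; last by rewrite ffunE uv addn1.
rewrite scale_configM; apply: reach_trans (reach_scale _ kx) (reach_fire _).
by rewrite /active nonsink_outdeg_gt0 ffunE leq_pmulr.
Qed.

Lemma reach_scale_beta_ge d :
  exists k x, reach (scale_config k (beta E s)) x /\ le_config d x.
Proof.
suff [k [x [kx le]]] : exists k x, reach (scale_config k (beta E s)) x /\
    {in enum (nonsink s), forall v, d v <= x v}.
  by exists k, x; split=> // v; rewrite le ?mem_enum.
elim: (enum _) => [|v l [k [x [kx le]]]].
  by exists 0, (scale_config 0 (beta E s)); split; first exact: reach_refl.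
have [k' [x' [kx' x'v]]] := reach_scale_beta_gt0 v.
exists (k + d v * k'), (add_config x (scale_config (d v) x')); split.
  by rewrite scale_configD scale_configM; apply/reach_add/reach_scale.
move=> w; rewrite inE !ffunE => /predU1P[->|/le dx].
  by apply: leq_trans (leq_addl _ _); rewrite leq_pmulr.
exact: leq_trans dx (leq_addr _ _).
Qed.

(* Dhar's burning criterion.  A configuration [d] with enough chips to fire
   every vertex once returns to itself when [beta] is added, which gives the
   direct implication by confluence.  Conversely [c + k beta] reaches [c], while
   the chips of [k beta] can be spread so as to dominate any given [d]. *)
Lemma recurrent_burning c :
  recurrent E c <-> stable E c /\ reach (add_config c (beta E s)) c.
Proof.
split=> [[stc accc]|[stc burn]]; split=> //.
  pose d : config s := [ffun v => outdeg E (val v)].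
  have count1 v : count_mem v (enum (nonsink s)) = 1.
    by rewrite count_uniq_mem ?enum_uniq // mem_enum.
  have dd : reach (add_config d (beta E s)) d.
    have [|ws1 v ws2 _|e l] :=
        @legal_exists (add_config d (beta E s)) (enum (nonsink s)).
    - exact: enum_uniq.
    - by rewrite nonsink_outdeg_gt0 !ffunE -addnA leq_addr.
    - by exists (enum (nonsink s)); rewrite -{2}(burning_end count1 l).
  have [d' dc] := accc d.
  apply: (@reach_stable_confluent
    (add_config (add_config d d') (beta E s))) => //.
    apply: reach_trans dc.
    rewrite -add_configA (add_configC d') add_configA.
    by apply: reach_add => //; apply: reach_refl.
  by apply: reach_add => //; apply: reach_refl.
move=> d; have [k [x [kx dx]]] := reach_scale_beta_ge d.
have ckc l : reach (add_config c (scale_config l (beta E s))) c.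
  elim: l => [|l IHl].
    rewrite (_ : add_config _ _ = c); first exact: reach_refl.
    by apply/ffunP => v; rewrite !ffunE addn0.
  rewrite -add1n scale_configD scale_config1 add_configA.
  apply: reach_trans IHl; apply: reach_add => //; exact: reach_refl.
(* The truncated difference is exact because [d <= x], so [d] plus this witness is [c + x]. *)
exists (add_config [ffun v => x v - d v] c).
rewrite (_ : add_config _ _ = add_config c x); last first.
  by apply/ffunP => v; rewrite !ffunE addnA subnKC ?dx // addnC.
apply: reach_stable_confluent (ckc k) _ => //.
by apply: reach_add kx; apply: reach_refl.
Qed.

(** * Minimal recurrent configurations and maximal acyclic arc sets *)

Definition indeg_config (A : {set T * T}) : config s :=
  [ffun v => outdeg E (val v) - indeg A (val v)].

(** Stability holds because every nonsink has an entering arc in [A]. Firing along a ranking of [A]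
    makes all arcs of [A] forward, so each vertex receives at least [indeg A] chips before its
    turn. *)
Lemma indeg_config_recurrent (A : {set T * T}) :
  A \subset E -> acyclic A -> (forall v : T, indeg A v = 0 <-> v = s) ->
  recurrent E (indeg_config A).
Proof.
move=> sAE /acyclic_ranked; set r := (X in ranked X _) => rA src.
apply/recurrent_burning; split=> [v|].
  rewrite /active nonsink_outdeg_gt0 ffunE andbT -ltnNge.
  rewrite ltn_subrL nonsink_outdeg_gt0 andbT lt0n.
  by apply: contra_neqN (valP v) => /eqP/src.
pose rr := relpre (fun v : nonsink s => r (val v)) leq.
pose ws := sort rr (enum (nonsink s)).
have rr_trans : transitive rr by move=> ? ? ?; apply: leq_trans.
have rr_refl : reflexive rr by move=> ?; apply: leqnn.
have sws : sorted rr ws by apply: sort_sorted => ? ?; apply: leq_total.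
have uws : uniq ws by rewrite sort_uniq enum_uniq.
have ws_all v : v \in ws by rewrite mem_sort mem_enum.
exists ws; apply: burning_legal => // v; rewrite ffunE -leq_subLR.
(* The double subtraction gives back [indeg A] because [indeg A <= indeg E = outdeg]. *)
rewrite -eulE subKn; last exact: indeg_sub.
apply/indeg_sub/subsetP => -[x y] xyA.
suff : arc (firing_arcs E ws) x y by [].
rewrite arc_firing_arcs // {1}/arc (subsetP sAE) //=.
have [ys|[y' yE]] := nonsinkP y.
  have := (src y).2 ys; apply: contra_eqT => _; rewrite -lt0n.
  by apply/indeg_gt0P; exists x.
rewrite yE firing_rank_val; have [->|[x' xE]] := nonsinkP x.
  by rewrite firing_rank_sink.
rewrite xE firing_rank_val ltnS ltnNge; apply/negP.
move/(sorted_leq_index rr_trans rr_refl sws _ _ (ws_all _) (ws_all _)).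
by rewrite /rr /= leqNgt -xE -yE rA.
Qed.

Lemma firing_graph_acyclic c F : is_firing_graph E c F -> acyclic F.
Proof.
case=> ws [l ->]; have [uws ws_all] := burning_uniq l.
apply: (@ranked_acyclic _ (firing_rank ws)) => u v.
by rewrite arc_firing_arcs // => /andP[].
Qed.

Lemma firing_graph_sub c F : is_firing_graph E c F -> F \subset E.
Proof.
case=> ws [l ->]; have [uws ws_all] := burning_uniq l.
apply/subsetP => -[u v] uv.
have : arc (firing_arcs E ws) u v by [].
by rewrite arc_firing_arcs // => /andP[].
Qed.

Lemma firing_graph_le c F : is_firing_graph E c F ->
  le_config (indeg_config F) c.
Proof.
by case=> ws [l ->] v; rewrite ffunE leq_subLR addnC burning_indeg.
Qed.

(** A nonsink of in-degree 0 would have to be active in [c] already, against stability; no vertex is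
    ranked below [s]. *)
Lemma firing_graph_source c F : stable E c -> is_firing_graph E c F ->
  forall v : T, indeg F v = 0 <-> v = s.
Proof.
move=> stc [ws [l ->]] v; have [uws ws_all] := burning_uniq l; split=> [|->].
  have [->//|[v' ->]] := nonsinkP v => F0.
  have := burning_indeg v' l; rewrite F0 addn0 => cv.
  by have := stc v'; rewrite /active cv nonsink_outdeg_gt0.
apply/eqP; rewrite -leqn0 leqNgt; apply/negP => /indeg_gt0P[u].
by rewrite arc_firing_arcs // firing_rank_sink ltn0 andbF.
Qed.

Lemma firing_graph_recurrent c F : stable E c -> is_firing_graph E c F ->
  recurrent E (indeg_config F).
Proof.
move=> stc cF; apply: indeg_config_recurrent.
- exact: firing_graph_sub cF.
- exact: firing_graph_acyclic cF.
- exact: firing_graph_source stc cF.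
Qed.

Lemma recurrent_firing_graph c : recurrent E c ->
  exists F, is_firing_graph E c F.
Proof.
by case/recurrent_burning => _ [ws l]; exists (firing_arcs E ws), ws.
Qed.

Lemma min_recurrent_indeg_config c F : min_recurrent E c ->
  is_firing_graph E c F -> c = indeg_config F.
Proof.
move=> [[stc _] minc] cF; apply/eqP; apply: contraT => /eqP ncF.
case: minc; exists (indeg_config F); split.
- exact: firing_graph_recurrent cF.
- exact/nesym.
- exact: firing_graph_le.
Qed.

(** If an arc [(u, v)] could be added, the larger set would give a recurrent configuration below
    [c], strictly so at [v]. *)
Lemma min_recurrent_maximal c F : min_recurrent E c -> is_firing_graph E c F ->
  max_acyclic_from E s F.
Proof.
move=> minc cF; have stc := minc.1.1.
have cE := min_recurrent_indeg_config minc cF.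
have sFE := firing_graph_sub cF; have src := firing_graph_source stc cF.
split=> //; split=> //; first exact: firing_graph_acyclic cF.
move=> [u v]; rewrite inE => /andP[uvF uvE] acA.
have sAE : (u, v) |: F \subset E by rewrite subUset sub1set uvE.
have := acyclic_ranked acA; set r := (X in ranked X _) => rA.
have rF : ranked r F by move=> x y xy; apply: rA; apply: setU1r.
have ruv : r u < r v by apply: rA; rewrite /arc setU11.
(* The only source [s] has the least rank, so an arc increasing the rank cannot end there. *)
have [vs|[v' vE]] := nonsinkP v.
  have := ranked_source_min rF (fun x => (src x).1) u.
  by rewrite leqNgt -vs ruv.
have recA : recurrent E (indeg_config ((u, v) |: F)).
  apply: indeg_config_recurrent => // w; rewrite indeg_setU1 //.
  have [->|_] := eqVneq w v; last exact: src.
  by split=> // vs; have := valP v'; rewrite /= -vE vs eqxx.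
have leA w : indeg_config ((u, v) |: F) w <= c w.
  by rewrite cE !ffunE leq_sub2l // indeg_setU1 // leq_addl.
(* The drop is strict because the enlarged in-degree is still at most [outdeg], so nothing is
   truncated. *)
have ltA : indeg_config ((u, v) |: F) v' < c v'.
  have := indeg_sub v sAE; rewrite cE !ffunE -vE indeg_setU1 // eqxx eulE.
  by move=> ?; apply: ltn_sub2l.
apply: minc.2; exists (indeg_config ((u, v) |: F)); split=> // cA.
by move: ltA; rewrite cA ltnn.
Qed.

(** Comparing [indeg_config F <= c <= indeg_config A] gives [indeg A <= indeg F] at nonsinks; at [s]
    the left side is 0. Then [maximal_acyclic_indeg] applies. *)
Lemma maximal_firing_graph (A : {set T * T}) c F : max_acyclic_from E s A ->
  le_config c (indeg_config A) -> is_firing_graph E c F -> F = A.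
Proof.
move=> [maxA src] le cF.
have sFE := firing_graph_sub cF.
apply: (maximal_acyclic_indeg maxA) => //; first exact: firing_graph_acyclic cF.
move=> v; have [vs|[v' vE]] := nonsinkP v; first by rewrite (src v).2.
have := leq_trans (firing_graph_le cF v') (le v').
by rewrite !ffunE -vE leq_sub2lE // -eulE indeg_sub //; case: maxA.
Qed.

(** A recurrent [c] below has a firing graph, which must be [A]; then [firing_graph_le] bounds [c]
    from below by [indeg_config A]. *)
Lemma indeg_config_min (A : {set T * T}) : max_acyclic_from E s A ->
  min_recurrent E (indeg_config A).
Proof.
move=> mA; have [[sAE acA _] src] := mA; split.
  exact: indeg_config_recurrent.
case=> c [recc neq le]; have [F cF] := recurrent_firing_graph recc.
have FA := maximal_firing_graph mA le cF.
apply: neq; apply/ffunP => v; apply/eqP; rewrite eqn_leq le /=.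
by rewrite -FA; apply: firing_graph_le.
Qed.

Lemma min_recurrent_firing_graph_uniq c F F' : min_recurrent E c ->
  is_firing_graph E c F -> is_firing_graph E c F' -> F = F'.
Proof.
move=> minc cF cF'; apply: (maximal_firing_graph _ _ cF).
  exact: min_recurrent_maximal cF'.
by rewrite (min_recurrent_indeg_config minc cF') => v.
Qed.

End ChipFiring.

Theorem theorem3 (T : finType) (E : {set T * T}) (s : T)
    (E_simple : loopless E) (E_connected : connected_digraph E)
    (E_eulerian : eulerian E) :
  (forall c : config s, min_recurrent E c ->
     exists! F : {set T * T}, is_firing_graph E c F) /\
  (exists f : config s -> {set T * T},
     (forall c : config s, min_recurrent E c -> is_firing_graph E c (f c)) /\
     set_bij (min_recurrent E (s := s)) (max_acyclic_from E s) f).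
Proof.
split=> [c minc|].
  have [F cF] := recurrent_firing_graph E_connected E_eulerian minc.1.
  by exists F; split=> // F'; apply: min_recurrent_firing_graph_uniq.
(* The default empty set is taken only where no firing graph exists, hence never at a minimal
   recurrent [c]. *)
pose f (c : config s) := xget finset.set0 (is_firing_graph E c).
have fP (c : config s) : min_recurrent E c -> is_firing_graph E c (f c).
  by move=> minc; apply: xgetPex; apply: recurrent_firing_graph minc.1.
exists f; split=> //; split.
- by move=> c minc; apply: min_recurrent_maximal (fP c minc).
- move=> c c' /set_mem minc /set_mem minc' fE.
  rewrite (min_recurrent_indeg_config E_connected E_eulerian minc (fP c minc)).
  by rewrite fE; apply/esym/min_recurrent_indeg_config; [| | |apply: fP].
- move=> A mA; have minA := indeg_config_min E_connected E_eulerian mA.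
  exists (indeg_config E s A) => //.
  exact: maximal_firing_graph mA _ (fP _ minA).
Qed.
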